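(* Let $(\mathcal{X},\mathscr{A})$ be a measurable space and, for each integer $k\ge1$, let $t_k:\mathcal{X}^k\to\mathbb{R}^m$ be measurable. Let $(\delta_1,\xi_1),(\delta_2,\xi_2),\ldots$ be independent copies of $(\delta,\xi)$, where $\delta$ is Bernoulli with parameter $p>0$ and $\xi$ is an $\mathcal{X}$-valued random variable. Let $T_{c,n}$ be the complete case statistic associated with the sequence $(t_n)$, and let $H_n$ be its distribution. Then for every Borel subset $B$ of $\mathbb{R}^m$, $$H_n(B)=P(T_{c,n}\in B)=\sum_{k=0}^n\binom nk p^k(1-p)^{n-k}R_k(B),$$ with $R_0(B)=\mathbf{1}[t_0(\xi^{\varnothing})\in B]$.
   Context: Let $\tilde Q$ be the conditional distribution of $\xi$ given $\delta=1$, and let $\tilde\xi_1,\tilde\xi_2,\ldots$ be independent with common distribution $\tilde Q$. For $k\ge1$, $R_k$ denotes the distribution of $t_k(\tilde\xi_1,\ldots,\tilde\xi_k)$. The complete case statistic associated with $(t_n)$ is $$T_{c,n}=\sum_{A\subset\{1,\ldots,n\}}\Bigl\{\prod_{i\in A}\delta_i\Bigr\}\Bigl\{\prod_{i\notin A}(1-\delta_i)\Bigr\}t_{|A|}(\xi^A),$$ where $t_0(\xi^{\varnothing})$ is a (fixed) constant in $\mathbb{R}^m$, $|A|$ is the cardinality of $A$, and $\xi^A=(\xi_{i_1},\ldots,\xi_{i_k})$ with $i_1<\cdots<i_k$ the elements of the non-empty set $A$. *)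

(* Defs.v *)
From HB Require Import structures.
From mathcomp Require Import all_boot all_order all_algebra finmap.
From mathcomp Require Import all_classical all_reals all_analysis.

Set Implicit Arguments.
Unset Strict Implicit.
Unset Printing Implicit Defensive.
Import Order.TTheory GRing.Theory Num.Theory.
Import numFieldNormedType.Exports.

Local Open Scope classical_set_scope.
Local Open Scope ring_scope.

(* [R^m] with its Borel sigma-algebra, generated by the open sets. *)
Definition borel_rV (R : realType) (m : nat) :=
  g_sigma_algebraType (@open 'rV[R]_m).

Section random_elements.
Context d d' (Om : measurableType d) (T : measurableType d').

Definition pair_RV d2 (T2 : measurableType d2)
    (U : {mfun Om >-> T}) (V : {mfun Om >-> T2}) : Om -> T * T2 :=
  fun w => (U w, V w).

Lemma pair_RV_measurable d2 (T2 : measurableType d2)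
    (U : {mfun Om >-> T}) (V : {mfun Om >-> T2}) :
  measurable_fun [set: Om] (pair_RV U V).
Proof. by apply/measurable_fun_pairP; split; exact: measurable_funPT. Qed.

HB.instance Definition _ d2 (T2 : measurableType d2)
    (U : {mfun Om >-> T}) (V : {mfun Om >-> T2}) :=
  isMeasurableFun.Build _ _ _ _ (pair_RV U V) (pair_RV_measurable U V).

Definition tuple_RV k (U : 'I_k -> {mfun Om >-> T}) : Om -> k.-tuple T :=
  fun w => [tuple U j w | j < k].

Lemma tuple_RV_measurable k (U : 'I_k -> {mfun Om >-> T}) :
  measurable_fun [set: Om] (tuple_RV U).
Proof.
apply/measurable_fun_tnthP => i.
rewrite (_ : _ \o _ = U i); last by apply/funext => w /=; rewrite tnth_mktuple.
exact: measurable_funPT.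
Qed.

HB.instance Definition _ k (U : 'I_k -> {mfun Om >-> T}) :=
  isMeasurableFun.Build _ _ _ _ (tuple_RV U) (tuple_RV_measurable U).

Definition mutually_independent (R : realType) (P : probability Om R)
    (Z : nat -> {mfun Om >-> T}) : Prop :=
  forall (J : {fset nat}) (E : nat -> set T),
    (forall j, j \in J -> measurable (E j)) ->
    P (\bigcap_(j in [set` J]) Z j @^-1` E j) =
    (\prod_(j <- J) P (Z j @^-1` E j))%E.

End random_elements.

(* The conditional distribution of [xi] given [delta = true]. *)
Definition cond_distribution d d' (Om : measurableType d)
    (X : measurableType d') (R : realType) (P : probability Om R)
    (delta : {mfun Om >-> bool}) (xi : {mfun Om >-> X}) (C : set X) : \bar R :=
  (P ((xi @^-1` C) `&` [set w | delta w = true]) /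
   P [set w | delta w = true])%E.

Section complete_case.
Context d d' (Om : measurableType d) (X : measurableType d') (R : realType).
Variable m : nat.
(* Since [0.-tuple X] has one element, [t 0] is a fixed vector. *)
Variable t : forall k, {mfun k.-tuple X >-> borel_rV R m}.
Variables (delta : nat -> {mfun Om >-> bool}) (xi : nat -> {mfun Om >-> X}).

(* [enum_val] lists the elements of [A] in increasing order. *)
Definition subtuple n (A : {set 'I_n}) : Om -> #|A|.-tuple X :=
  tuple_RV (fun j : 'I_#|A| => xi (enum_val j)).

Definition complete_case n (w : Om) : borel_rV R m :=
  (\sum_(A : {set 'I_n})
    ((\prod_(i in A) (delta i w)%:R) *
     (\prod_(i | i \notin A) (1 - (delta i w)%:R))) *:
    t #|A| (subtuple A w) : 'rV[R]_m).

Lemma complete_caseE n w :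
  let A := [set i : 'I_n | delta i w]%SET in
  complete_case n w = t #|A| (subtuple A w).
Proof.
move=> A; rewrite /complete_case (bigD1 A)//=.
rewrite [X in X + _ = _](_ : _ = t #|A| (subtuple A w)).
  rewrite big1 ?addr0// => B BA.
  suff -> : (\prod_(i in B) (delta i w)%:R) *
     (\prod_(i | i \notin B) (1 - (delta i w)%:R)) = 0 :> R by rewrite scale0r.
  have [i iBA] : exists i, (i \in B) != (i \in A).
    apply/existsP; apply: contraNT BA => /existsPn h.
    by apply/eqP/setP => i; apply/eqP; rewrite -[_ == _]negbK.
  apply/eqP; rewrite mulf_eq0; case: (boolP (i \in B)) iBA => iB;
    rewrite inE => iA.
  - apply/orP; left; rewrite (bigD1 i)//=.
    by case: (delta i w) iA => //= _; rewrite mul0r.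
  - apply/orP; right; rewrite (bigD1 i)//=.
    by case: (delta i w) iA => //= _; rewrite subrr mul0r.
rewrite !big1 ?mulr1 ?scale1r//.
- by move=> i; rewrite inE => /negbTE ->; rewrite subr0.
- by move=> i; rewrite inE => ->.
Qed.

Lemma complete_case_measurable n : measurable_fun [set: Om] (complete_case n).
Proof.
move=> _ B mB; rewrite setTI.
rewrite [X in measurable X](_ : _ = \big[setU/set0]_(A : {set 'I_n})
   ((\big[setI/setT]_(i : 'I_n) delta i @^-1` [set (i \in A)]) `&`
    (t #|A| \o tuple_RV (fun j : 'I_#|A| => xi (enum_val j))) @^-1` B)).
  apply: bigsetU_measurable => A _; apply: measurableI.
    apply: bigsetI_measurable => i _.
    by rewrite -[X in measurable X]setTI; exact: measurable_funPT.
  by rewrite -[X in measurable X]setTI; exact: measurable_funPT.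
apply/seteqP; split=> w /=.
  rewrite complete_caseE => Bw.
  rewrite -bigcup_seq/=; exists [set i : 'I_n | delta i w]%SET => /=.
    by rewrite mem_index_enum.
  by split=> //; rewrite -bigcap_seq/= => i _ /=; rewrite inE.
rewrite -bigcup_seq/= => -[A _ [+ Bw]]; rewrite -bigcap_seq => dA.
rewrite complete_caseE (_ : [set i : 'I_n | delta i w]%SET = A)//.
by apply/setP => i; rewrite inE; apply: dA; rewrite /= mem_index_enum.
Qed.

HB.instance Definition _ n :=
  isMeasurableFun.Build _ _ _ _ (complete_case n) (complete_case_measurable n).

End complete_case.

(* [t] evaluated at the first [k] terms of [xi], for [k > 0]; the value at
   [k = 0] is the unit mass at the constant [t 0]. *)
Definition stat_distribution d d' (Om : measurableType d)
    (X : measurableType d') (R : realType) (P : probability Om R) (m : nat)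
    (t : forall k, {mfun k.-tuple X >-> borel_rV R m})
    (xi : nat -> {mfun Om >-> X}) (k : nat) (B : set (borel_rV R m)) :
    \bar R :=
  if k is 0%N then (\1_B (t 0%N [tuple]))%:E
  else distribution P (t k \o tuple_RV (fun j : 'I_k => xi j)) B.

(* Main.v *)
(* Decompose the event [T_{c,n} in B] according to the set [A] of observed
   indices.  On the pattern [A] the statistic is [t_{|A|}(xi^A)], and for a
   rectangle of measurable sets, independence of the pairs factors
   [P(pattern A, xi^A in rectangle)] into [p^|A| (1-p)^(n-|A|)] times the
   product of the [Q~]-masses of the sides.  Two finite measures that agree on
   rectangles are equal, so the same holds for every measurable set of tuples; it then
   remains to count the sets [A] of each cardinality. *)
Require Import Defs.
From HB Require Import structures.
From mathcomp Require Import all_boot all_order all_algebra finmap.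
From mathcomp Require Import all_classical all_reals all_analysis.
Import Order.TTheory GRing.Theory Num.Theory.
Import numFieldNormedType.Exports.
Local Open Scope classical_set_scope.
Local Open Scope ring_scope.

Set Implicit Arguments.
Unset Strict Implicit.
Unset Printing Implicit Defensive.

(** * Rectangles in a tuple space as a generating pi-system *)

Section boxes.
Context d (T : measurableType d) (k : nat).

Definition box (E : 'I_k -> set T) : set (k.-tuple T) :=
  [set x | forall j, E j (tnth x j)].

Definition boxes : set (set (k.-tuple T)) :=
  [set C | exists2 E : 'I_k -> set T, (forall j, measurable (E j)) & C = box E].

Lemma boxT : box (fun=> setT) = setT.
Proof. by apply/seteqP; split. Qed.

Lemma box_measurable (E : 'I_k -> set T) :
  (forall j, measurable (E j)) -> measurable (box E).
Proof.
move=> mE.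
rewrite [X in measurable X](_ : _ =
  \big[setI/setT]_(j < k) ((@tnth k T)^~ j @^-1` E j)).
  apply: bigsetI_measurable => j _.
  by rewrite -[X in measurable X]setTI; exact: measurable_tnth.
rewrite -bigcap_seq/=; apply/seteqP; split=> x Ex j.
  by move=> _; exact: Ex.
by apply: (Ex j); rewrite /= mem_index_enum.
Qed.

(** The tuple sigma-algebra is generated by preimages under single coordinates, and each of these is
    a box whose other sides are [setT]. *)
Lemma measurable_tuple_boxes : measurable = <<s boxes >>.
Proof.
apply/seteqP; split; last first.
  apply: smallest_sub; first exact: sigma_algebra_measurable.
  by move=> _ [E mE ->]; exact: box_measurable.
apply: smallest_sub; first exact: smallest_sigma_algebra.
rewrite -bigcup_seq/= => C [i _ [D mD <-]].
apply: sub_sigma_algebra.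
exists (fun j => if j == i then D else setT); first by move=> j; case: ifP.
apply/seteqP; split=> x /=.
  by move=> [_ Dx] j; case: eqP => // ->.
by move=> /(_ i); rewrite eqxx.
Qed.

Lemma boxes_setI_closed : setI_closed boxes.
Proof.
move=> _ _ [E mE ->] [F mF ->]; exists (fun j => E j `&` F j).
  by move=> j; exact: measurableI.
apply/seteqP; split=> x /=; first by case=> Ex Fx j.
by move=> EFx; split=> j; case: (EFx j).
Qed.

(** Uniqueness of measures on a generating pi-system; since [m1] is finite and [setT] is itself a
    box, the constant sequence [setT] serves as the exhausting cover. *)
Lemma measure_eq_boxes (R : realType)
    (m1 m2 : {measure set (k.-tuple T) -> \bar R}) :
  (m1 setT < +oo)%E ->
  (forall E, (forall j, measurable (E j)) -> m1 (box E) = m2 (box E)) ->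
  forall C, measurable C -> m1 C = m2 C.
Proof.
move=> m1oo m12 C mC; apply: (measure_unique boxes (fun=> setT)) mC => //.
- exact: measurable_tuple_boxes.
- exact: boxes_setI_closed.
- by move=> _; exists (fun=> setT) => //; rewrite boxT.
- by rewrite bigcup_const//; exists 0%N.
- by move=> _ [E mE ->]; exact: m12.
Qed.

End boxes.

(** Restates independence for families indexed by ordinals, the form needed both for the [n] pairs
    and for the [#|A|] coordinates of a subtuple. *)
Lemma mutually_independent_ord d d' (Om : measurableType d)
    (T : measurableType d') (R : realType) (P : probability Om R)
    (Z : nat -> {mfun Om >-> T}) n (E : 'I_n -> set T) :
  mutually_independent P Z -> (forall i, measurable (E i)) ->
  P [set w | forall i : 'I_n, E i (Z i w)] =
  (\prod_(i < n) P (Z i @^-1` E i))%E.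
Proof.
move=> indep mE.
(* Independence expects events indexed by all of [nat], so the family is extended by [setT] from [n]
   on. *)
pose F (i : nat) := if insub i is Some j then E j else setT.
have FE (i : 'I_n) : F i = E i by rewrite /F valK.
have mF i : measurable (F i) by rewrite /F; case: insub.
pose J := [fset i | i in iota 0 n]%fset.
have memJ i : (i \in J) = (i < n)%N.
  by apply/imfsetP/idP => [[j /= + ->]|ltin];
    [rewrite mem_iota|exists i; rewrite //= mem_iota].
transitivity (P (\bigcap_(j in [set` J]) Z j @^-1` F j)).
  congr (P _); apply/seteqP; split=> w /= Ew.
    by move=> i /=; rewrite memJ => ltin; rewrite (FE (Ordinal ltin)).
  by move=> i; rewrite -FE; apply: Ew; rewrite /= memJ.
rewrite indep; last by move=> j _; exact: mF.
rewrite (perm_big (index_iota 0 n)).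
  rewrite big_mkord.
  by apply: eq_bigr => i _; rewrite FE.
apply: uniq_perm; [exact: fset_uniq|exact: iota_uniq|move=> i].
by rewrite memJ mem_index_iota.
Qed.

Lemma prode_const (R : realType) (I : finType) (A : {pred I}) (c : R) :
  (\prod_(i in A) c%:E)%E = (c ^+ #|A|)%:E.
Proof. by rewrite -(big_morph EFin (@EFinM R) erefl) prodr_const. Qed.

Lemma sume_const (R : realType) (I : finType) (A : {pred I}) (x : \bar R) :
  (\sum_(i in A) x = #|A|%:R%:E * x)%E.
Proof.
rewrite mule_natl sumr_const.
by elim: #|A| => // k IH; rewrite mulrS IH enatmulS.
Qed.

(** * Laws of one pair, of one observation pattern, and of the complete case statistic *)

Section copies.
Context (R : realType) (dX : measure_display) (X : measurableType dX).
Context (p : R) (p_gt0 : 0 < p) (p_le1 : p <= 1).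
Context (d0 : measure_display) (Om0 : measurableType d0).
Context (P0 : probability Om0 R).
Context (delta0 : {RV P0 >-> bool}) (xi0 : {RV P0 >-> X}).
Context (delta0_bernoulli : distribution P0 delta0 =1 bernoulli_prob p).
Context (d : measure_display) (Om : measurableType d) (P : probability Om R).
Context (delta : nat -> {RV P >-> bool}) (xi : nat -> {RV P >-> X}).
Context (copies_indep :
  mutually_independent P (fun i => pair_RV (delta i) (xi i))).
Context (copies_distr : forall (i : nat) (E : set (bool * X)), measurable E ->
  distribution P (pair_RV (delta i) (xi i)) E =
  distribution P0 (pair_RV delta0 xi0) E).
Context (d1 : measure_display) (Om1 : measurableType d1).
Context (P1 : probability Om1 R) (xit : nat -> {RV P1 >-> X}).
Context (xit_indep : mutually_independent P1 xit).
Context (xit_distr : forall (i : nat) (C : set X), measurable C ->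
  distribution P1 (xit i) C = cond_distribution P0 delta0 xi0 C).

Let p01 : 0 <= p <= 1. Proof. by rewrite (ltW p_gt0). Qed.

Lemma observed_prob : P0 [set w | delta0 w = true] = p%:E.
Proof.
transitivity (distribution P0 delta0 [set true]) => //.
rewrite delta0_bernoulli bernoulli_probE// !diracE.
by rewrite mem_set// memNset//= mule1 mule0 adde0.
Qed.

Lemma missing_prob : P0 [set w | delta0 w = false] = (1 - p)%:E.
Proof.
transitivity (distribution P0 delta0 [set false]) => //.
rewrite delta0_bernoulli bernoulli_probE// !diracE.
by rewrite memNset//= mem_set// mule1 mule0 add0e.
Qed.

(** The conditional probability is a quotient with denominator [p], which cancels because [p > 0].
    The index [j] is free since all [xit j] have the same law. *)
Lemma observed_copy_law i j (C : set X) : measurable C ->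
  P (pair_RV (delta i) (xi i) @^-1` ([set true] `*` C)) =
  (p%:E * P1 (xit j @^-1` C))%E.
Proof.
move=> mC.
have mTC : measurable ([set true] `*` C) by exact: measurableX.
rewrite -[LHS]/(distribution P (pair_RV (delta i) (xi i)) _) copies_distr//.
rewrite -[P1 _]/(distribution P1 (xit j) C) xit_distr//.
rewrite /cond_distribution observed_prob.
have -> : distribution P0 (pair_RV delta0 xi0) ([set true] `*` C) =
    P0 ((xi0 @^-1` C) `&` [set w | delta0 w = true]).
  by congr (P0 _); apply/seteqP; split=> w [].
by rewrite inver gt_eqF// muleCA -EFinM divff ?gt_eqF// mule1.
Qed.

Lemma missing_copy_law i :
  P (pair_RV (delta i) (xi i) @^-1` ([set false] `*` setT)) = (1 - p)%:E.
Proof.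
have mFT : measurable ([set false] `*` [set: X]) by exact: measurableX.
rewrite -[LHS]/(distribution P (pair_RV (delta i) (xi i)) _) copies_distr//.
by rewrite -missing_prob; congr (P0 _); apply/seteqP; split=> w // [].
Qed.

Definition pattern n (A : {set 'I_n}) : set Om :=
  [set w | forall i : 'I_n, delta i w = (i \in A)].

Lemma pattern_measurable n (A : {set 'I_n}) : measurable (pattern A).
Proof.
rewrite [X in measurable X](_ : _ =
  \big[setI/setT]_(i < n) (delta i @^-1` [set i \in A])).
  apply: bigsetI_measurable => i _.
  by rewrite -[X in measurable X]setTI; exact: measurable_funPT.
rewrite -bigcap_seq/=; apply/seteqP; split=> w dA i.
  by move=> _; exact: dA.
by apply: (dA i); rewrite /= mem_index_enum.
Qed.

(** The event is a product event in the [n] pairs: an index in [A] contributes [[set true]] times a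
    side of the box, any other index [[set false]] times [setT]. *)
Lemma pattern_box_prob n (A : {set 'I_n}) (E : 'I_#|A| -> set X) :
  (forall j, measurable (E j)) ->
  P (subtuple xi A @^-1` box E `&` pattern A) =
  ((p ^+ #|A| * (1 - p) ^+ (n - #|A|))%:E *
   P1 (tuple_RV (fun j : 'I_#|A| => xit j) @^-1` box E))%E.
Proof.
move=> mE.
(* The intersection is [E j] when [i = enum_val j], and [setT] when [i] is not
   in [A]. *)
pose F (i : 'I_n) :=
  [set i \in A] `*` \bigcap_(j in [set j | enum_val j = i]) E j.
have mF i : measurable (F i).
  by apply: measurableX => //; apply: fin_bigcap_measurable.
have -> : subtuple xi A @^-1` box E `&` pattern A =
    [set w | forall i : 'I_n, F i (pair_RV (delta i) (xi i) w)].
  apply/seteqP; split=> w /=.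
    move=> [Ew dA] i; split=> /=; first exact: dA.
    by move=> j /= <-; have := Ew j; rewrite tnth_mktuple.
  move=> Fw; split=> [j|i]; last by have [] := Fw i.
  by rewrite tnth_mktuple; have [_] := Fw (enum_val j); exact.
have -> : tuple_RV (fun j : 'I_#|A| => xit j) @^-1` box E =
    [set w | forall j : 'I_#|A|, E j (xit j w)].
  by apply/seteqP; split=> w Ew j; have := Ew j; rewrite /= tnth_mktuple.
rewrite (mutually_independent_ord copies_indep)//.
rewrite (mutually_independent_ord xit_indep)//.
(* Observed and missing indices are separated; the observed factors are then reindexed along
   [enum_val], matching position [j] of the subtuple with [xit j]. *)
rewrite (bigID (mem A))/= [X in (_ * X)%E](_ : _ = ((1 - p) ^+ (n - #|A|))%:E).
  rewrite big_enum_val/=.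
  under eq_bigr => j _.
    rewrite [F _](_ : _ = [set true] `*` E j); last first.
      rewrite /F enum_valP; congr (_ `*` _).
      apply/seteqP; split=> x; first by apply.
      by move=> Ex j' /= /enum_val_inj ->.
    rewrite (observed_copy_law _ j)//.
    over.
  by rewrite big_split/= prode_const card_ord muleAC EFinM.
rewrite [in RHS](_ : (n - #|A|)%N = #|[predC A]|); last first.
  by rewrite -[X in (X - _)%N](card_ord n) -(cardC A) addKn.
rewrite -prode_const; apply: eq_bigr => i iA.
rewrite [F _](_ : _ = [set false] `*` setT); last first.
  rewrite /F (negbTE iA); congr (_ `*` _).
  apply/seteqP; split=> // x _ j /= ji.
  by move: iA; rewrite -ji enum_valP.
exact: missing_copy_law.
Qed.

Lemma pattern_subtuple_prob n (A : {set 'I_n}) (C : set (#|A|.-tuple X)) :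
  measurable C ->
  P (subtuple xi A @^-1` C `&` pattern A) =
  ((p ^+ #|A| * (1 - p) ^+ (n - #|A|))%:E *
   P1 (tuple_RV (fun j : 'I_#|A| => xit j) @^-1` C))%E.
Proof.
have c0 : 0 <= p ^+ #|A| * (1 - p) ^+ (n - #|A|).
  by rewrite mulr_ge0// exprn_ge0 ?subr_ge0// ltW.
(* As functions of [C], the two sides are the image under the subtuple of [P] restricted to the
   pattern, and a multiple of the law of the first [#|A|] terms of [xit]. *)
apply: (measure_eq_boxes
  (m1 := pushforward (mrestr P (pattern_measurable A)) (subtuple xi A))
  (m2 := mscale (NngNum c0)
           (distribution P1 (tuple_RV (fun j : 'I_#|A| => xit j))))).
- rewrite /= /pushforward /mrestr preimage_setT setTI.
  rewrite (le_lt_trans (probability_le1 _ _)) ?ltry//.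
  exact: pattern_measurable.
- exact: pattern_box_prob.
Qed.

(** Removes the case split at [k = 0]: the empty tuple is the only [0]-tuple, so the preimage is
    everything or nothing and has mass 1 or 0. *)
Lemma stat_distributionE m (t : forall k, {mfun k.-tuple X >-> borel_rV R m})
    k (B : set (borel_rV R m)) :
  stat_distribution P1 t xit k B =
  P1 (tuple_RV (fun j : 'I_k => xit j) @^-1` (t k @^-1` B)).
Proof.
case: k => [|k] //=; rewrite indicE.
have [Bt|Bt] := boolP (t 0 [tuple] \in B).
  rewrite -(probability_setT P1); congr (P1 _); apply/seteqP; split=> // w _ /=.
  by rewrite tuple0; exact: set_mem.
rewrite -[LHS](measure0 P1); congr (P1 _); apply/seteqP; split=> // w /=.
by rewrite tuple0 => /mem_set; rewrite (negbTE Bt).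
Qed.

Lemma complete_case_prob m (t : forall k, {mfun k.-tuple X >-> borel_rV R m})
    n (B : set (borel_rV R m)) : measurable B ->
  P [set w | B (complete_case t delta xi n w)] =
  (\sum_(A : {set 'I_n}) (p ^+ #|A| * (1 - p) ^+ (n - #|A|))%:E *
     stat_distribution P1 t xit #|A| B)%E.
Proof.
move=> mB.
have mtB k : measurable (t k @^-1` B).
  by rewrite -[X in measurable X]setTI; exact: measurable_funPT.
pose F (A : {set 'I_n}) := subtuple xi A @^-1` (t #|A| @^-1` B) `&` pattern A.
(* A sample point determines its pattern; this gives the disjointness of the [F A] and identifies
   the term selected by [complete_caseE]. *)
have FE A w : pattern A w -> [set i : 'I_n | delta i w]%SET = A.
  by move=> dA; apply/setP => i; rewrite inE dA.
have -> : [set w | B (complete_case t delta xi n w)] =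
    \bigcup_(A in [set` index_enum {set 'I_n}]) F A.
  apply/seteqP; split=> w /=.
    rewrite complete_caseE => Bw.
    exists [set i : 'I_n | delta i w]%SET; first by rewrite /= mem_index_enum.
    by split=> // i; rewrite inE.
  by move=> [A _ [Bw /FE dA]]; rewrite complete_caseE dA.
rewrite measure_fin_bigcup//.
- rewrite -fsbig_seq ?index_enum_uniq//; apply: eq_bigr => A _.
  by rewrite stat_distributionE; exact: (pattern_subtuple_prob (mtB _)).
- by move=> A A' _ _ [w [[_ /FE <-] [_ /FE <-]]].
- move=> A _; apply: measurableI; last exact: pattern_measurable.
  rewrite -[X in measurable X]setTI.
  exact: (tuple_RV_measurable _ measurableT (mtB _)).
Qed.

End copies.

Theorem lemma2p1 (R : realType) (m : nat)
    (dX : measure_display) (X : measurableType dX)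
    (t : forall k : nat, {mfun k.-tuple X >-> borel_rV R m})
    (p : R) (p_gt0 : 0 < p) (p_le1 : p <= 1)
    (* the generic pair (delta, xi) *)
    (d0 : measure_display) (Om0 : measurableType d0) (P0 : probability Om0 R)
    (delta0 : {RV P0 >-> bool}) (xi0 : {RV P0 >-> X})
    (delta0_bernoulli : distribution P0 delta0 =1 bernoulli_prob p)
    (* its independent copies *)
    (d : measure_display) (Om : measurableType d) (P : probability Om R)
    (delta : nat -> {RV P >-> bool}) (xi : nat -> {RV P >-> X})
    (copies_indep :
      mutually_independent P (fun i => pair_RV (delta i) (xi i)))
    (copies_distr : forall (i : nat) (E : set (bool * X)), measurable E ->
      distribution P (pair_RV (delta i) (xi i)) E =
      distribution P0 (pair_RV delta0 xi0) E)
    (* independent variables with the conditional distribution of xi given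
       delta = 1 *)
    (d1 : measure_display) (Om1 : measurableType d1) (P1 : probability Om1 R)
    (xit : nat -> {RV P1 >-> X})
    (xit_indep : mutually_independent P1 xit)
    (xit_distr : forall (i : nat) (C : set X), measurable C ->
      distribution P1 (xit i) C = cond_distribution P0 delta0 xi0 C)
    (n : nat) (B : set (borel_rV R m)) (mB : measurable B) :
  distribution P (complete_case t delta xi n) B =
    P [set w | B (complete_case t delta xi n w)] /\
  P [set w | B (complete_case t delta xi n w)] =
    (\sum_(k < n.+1)
       ('C(n, k)%:R * p ^+ k * (1 - p) ^+ (n - k))%:E *
       stat_distribution P1 t xit k B)%E.

Proof.
split=> //.
rewrite (complete_case_prob p_gt0 p_le1 delta0_bernoulli copies_indep
  copies_distr xit_indep xit_distr)//.
have cardA (A : {set 'I_n}) : (#|A| < n.+1)%N.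
  by rewrite ltnS -[X in (_ <= X)%N](card_ord n) max_card.
(* The summand depends on [A] only through its cardinality, so the sets are grouped by size; each
   class then contributes a constant times its number of sets, a binomial coefficient. *)
rewrite (partition_big (fun A : {set 'I_n} => Ordinal (cardA A)) predT)//=.
apply: eq_bigr => k _.
transitivity (\sum_(A in [set A : {set 'I_n} | #|A| == k :> nat]%SET)
  ((p ^+ k * (1 - p) ^+ (n - k))%:E * stat_distribution P1 t xit k B))%E.
  by apply: eq_big => [A|A /eqP <-//]; rewrite inE.
rewrite sume_const (_ : #|_| = 'C(n, k)); last by rewrite card_draws card_ord.
by rewrite muleA -EFinM mulrA.
Qed.
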